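(* Given fixed transit utilities $V_{od}^{pt}$, $(o,d)\in\tilde D$, the AMoD profit maximization problem (defined in the context) is mathematically equivalent to the following minimization problem over the physical network flows: $$\min_{\boldsymbol{x}^a,\boldsymbol{f},\boldsymbol{r}}\ \sum_{(o,d)\in\tilde D}\Big(x_{od}^a\ln x_{od}^a-x_{od}^a\ln(\alpha_{od}-x_{od}^a)+x_{od}^aV_{od}^{pt}\Big)+\sum_{(i,j)\in\mathcal E^a}C_{ij}f_{ij}+\mathrm{VOT}\sum_{(i,j)\in\mathcal E^a}(f_{ij}-r_{ij})\,T(b_{ij}+f_{ij}),$$ by eliminating the nonconvex travel-time and choice constraints (T) and (L) (the prices no longer appear, and the remaining constraints are the linear network constraints (F), (C), (D), (N)).
   Context: Data. $(\mathcal V^a,\mathcal E^a)$ is a strongly connected directed road graph; $\tilde D$ is the set of origin-destination pairs, which are ordered pairs of distinct nodes of a walking network that shares nodes with the road network, with demands $\alpha_{od}>0$; for each $(o,d)\in\tilde D$, $P_a^{od}$ is a set of candidate road paths; $\delta_{ij}^p\in\{0,1\}$ indicates whether road edge $(i,j)$ lies on path $p$. Constants: $C_{ij}$ (operating cost coefficients), $b_{ij}$ (exogenous background traffic), $\mathrm{VOT}>0$ (value of time). The road travel time on edge $(i,j)$ is the nondecreasing BPR function $T(q)=t_{ij}^0[1+\alpha_B(q/c_{ij})^\beta]$, where $t_{ij}^0$ and $c_{ij}$ are free-flow travel time and capacity and $\alpha_B,\beta$ are the BPR parameters. For a road node $v$, $e^-(v)$ and $e^+(v)$ are the sets of incoming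 and outgoing road edges. AMoD (autonomous mobility-on-demand) profit maximization problem, with the transit action and hence the transit utilities $V_{od}^{pt}$ fixed: over path flows $x_{od,p}^a$ and total demands $x_{od}^a$ (collectively $\boldsymbol{x}^a$), vehicle flows $f_{ij}$, rebalancing flows $r_{ij}$ and prices $\pi_{od}$, maximize $$\sum_{(o,d)\in\tilde D}\pi_{od}x_{od}^a-\sum_{(i,j)\in\mathcal E^a}C_{ij}f_{ij}$$ subject to (F) $f_{ij}=r_{ij}+\sum_{(o,d)\in\tilde D}\sum_{p\in P_a^{od}}x_{od,p}^a\delta_{ij}^p$ for all $(i,j)\in\mathcal E^a$; (C) $\sum_{(i,v)\in e^-(v)}r_{iv}-\sum_{(v,j)\in e^+(v)}r_{vj}=\sum_{(v,d)\in\tilde D}\sum_{p\in P_a^{vd}}x_{vd,p}^a-\sum_{(o,v)\in\tilde D}\sum_{p\in P_a^{ov}}x_{ov,p}^a$ for all $v\in\mathcal V^a$; (D) $x_{od}^a=\sum_{p\in P_a^{od}}x_{od,p}^a$ and $x_{od}^{pt}=\alpha_{od}-x_{od}^a$ (definitions of total AMoD and transit demand) for all $(o,d)\in\tilde D$; (T) $t_{od}^a=\sum_{p\in P_a^{od}}\frac{x_{od,p}^a}{x_{od}^a}\sum_{(i,j)\in\mathcal E^a}T(b_{ij}+f_{ij})\delta_{ij}^p$ for all $(o,d)\in\tilde D$; (V) $V_{od}^a=-\mathrm{VOT}\cdot t_{od}^a-\pi_{od}$ for all $(o,d)\in\tilde D$; (L) $x_{od}^a=\alpha_{od}\,e^{V_{od}^a}/(e^{V_{od}^a}+e^{V_{od}^{pt}})$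 for all $(o,d)\in\tilde D$; (N) $x_{od,p}^a,\ x_{od}^{pt},\ r_{ij}\ge0$. *)

(* Defs.v *)
From HB Require Import structures.
From mathcomp Require Import all_boot all_order all_algebra.
From mathcomp Require Import finmap.
From mathcomp Require Import all_classical all_reals all_analysis.
Set Implicit Arguments.
Unset Strict Implicit.
Unset Printing Implicit Defensive.
Import Order.TTheory GRing.Theory Num.Theory.
Local Open Scope ring_scope.

(* The road and the walking network live on a common finite type N of nodes,
   so that they may share nodes.  A road edge (i, j) and an origin-destination
   pair (o, d) are both elements of N * N; a path is its sequence of nodes. *)
Record amod_data (R : realType) (N : finType) := AmodData {
  road_nodes : {set N};
  road_edges : {set N * N};
  walk_nodes : {set N};
  od_pairs : {set N * N};
  demand : N * N -> R;                        (* alpha_od *)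
  cand_paths : N * N -> {fset (seq N)};       (* P_a^od *)
  op_cost : N * N -> R;                       (* C_ij *)
  background : N * N -> R;                    (* b_ij *)
  free_flow_time : N * N -> R;                (* t^0_ij *)
  capacity : N * N -> R;                      (* c_ij *)
  bpr_alpha : R;
  bpr_beta : R;
  VOT : R;
  transit_utility : N * N -> R                (* V^pt_od *)
}.

Record flows (R : realType) (N : finType) := Flows {
  path_flow : N * N -> seq N -> R;            (* x^a_{od,p} *)
  amod_demand : N * N -> R;                   (* x^a_od *)
  vehicle_flow : N * N -> R;                  (* f_ij *)
  rebalancing : N * N -> R                    (* r_ij *)
}.

Section Amod.
Variables (R : realType) (N : finType) (A : amod_data R N).

Definition road_rel : rel N := [rel i j | (i, j) \in road_edges A].

Definition is_road_path (w : N * N) (p : seq N) : bool :=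
  if p is u :: q then [&& u == w.1, path road_rel u q & last u q == w.2]
  else false.

Record valid_data : Prop := ValidData {
  edge_ends : forall e, e \in road_edges A ->
    e.1 \in road_nodes A /\ e.2 \in road_nodes A;
  strongly_connected : forall u v, u \in road_nodes A -> v \in road_nodes A ->
    connect road_rel u v;
  od_ends : forall w, w \in od_pairs A ->
    [/\ w.1 \in walk_nodes A, w.2 \in walk_nodes A & w.1 != w.2];
  demand_gt0 : forall w, w \in od_pairs A -> 0 < demand A w;
  cand_pathsP : forall w p, w \in od_pairs A -> p \in cand_paths A w ->
    is_road_path w p;
  free_flow_time_ge0 : forall e, e \in road_edges A -> 0 <= free_flow_time A e;
  capacity_gt0 : forall e, e \in road_edges A -> 0 < capacity A e;
  bpr_alpha_ge0 : 0 <= bpr_alpha A;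
  bpr_beta_ge0 : 0 <= bpr_beta A;
  VOT_gt0 : 0 < VOT A
}.

(* delta_ij^p; the edges of p are its pairs of consecutive nodes. *)
Definition on_path (e : N * N) (p : seq N) : R := (e \in zip p (behead p))%:R.

Definition travel_time (e : N * N) (q : R) : R :=
  free_flow_time A e * (1 + bpr_alpha A * (q / capacity A e) `^ bpr_beta A).

Definition transit_demand (z : flows R N) (w : N * N) : R :=
  demand A w - amod_demand z w.

Definition amod_time (z : flows R N) (w : N * N) : R :=
  \sum_(p <- cand_paths A w) path_flow z w p / amod_demand z w *
    \sum_(e in road_edges A)
       travel_time e (background A e + vehicle_flow z e) * on_path e p.

Definition amod_utility (z : flows R N) (price : N * N -> R) (w : N * N) : R :=
  - VOT A * amod_time z w - price w.

Record flow_feasible (z : flows R N) : Prop := FlowFeasible {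
  vehicle_flowE : forall e, e \in road_edges A ->
    vehicle_flow z e = rebalancing z e +
      \sum_(w in od_pairs A) \sum_(p <- cand_paths A w)
         path_flow z w p * on_path e p;
  rebalancing_balance : forall v, v \in road_nodes A ->
    \sum_(e in road_edges A | e.2 == v) rebalancing z e -
    \sum_(e in road_edges A | e.1 == v) rebalancing z e =
    \sum_(w in od_pairs A | w.1 == v)
       \sum_(p <- cand_paths A w) path_flow z w p -
    \sum_(w in od_pairs A | w.2 == v)
       \sum_(p <- cand_paths A w) path_flow z w p;
  amod_demandE : forall w, w \in od_pairs A ->
    amod_demand z w = \sum_(p <- cand_paths A w) path_flow z w p;
  path_flow_ge0 : forall w p, w \in od_pairs A -> p \in cand_paths A w ->
    0 <= path_flow z w p;
  transit_demand_ge0 : forall w, w \in od_pairs A -> 0 <= transit_demand z w;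
  rebalancing_ge0 : forall e, e \in road_edges A -> 0 <= rebalancing z e
}.

(* The logit constraint, with the definitions of travel time and utility
   substituted.  It forces a positive demand on every origin-destination pair,
   so that the division in amod_time is a genuine one. *)
Definition amod_feasible (y : flows R N * (N * N -> R)) : Prop :=
  flow_feasible y.1 /\
  forall w, w \in od_pairs A ->
    amod_demand y.1 w =
      demand A w * (expR (amod_utility y.1 y.2 w) /
        (expR (amod_utility y.1 y.2 w) + expR (transit_utility A w))).

Definition profit (y : flows R N * (N * N -> R)) : R :=
  \sum_(w in od_pairs A) y.2 w * amod_demand y.1 w -
  \sum_(e in road_edges A) op_cost A e * vehicle_flow y.1 e.

(* Extended-real valued: lne 0 = -oo and 0 * -oo = 0, so the entropy terms
   follow the usual conventions 0 ln 0 = 0 and - a ln 0 = +oo for a > 0. *)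
Definition flow_cost (z : flows R N) : \bar R :=
  (\sum_(w in od_pairs A)
     ((amod_demand z w)%:E * lne (amod_demand z w)%:E
      - (amod_demand z w)%:E * lne (demand A w - amod_demand z w)%:E
      + (amod_demand z w * transit_utility A w)%:E)
   + (\sum_(e in road_edges A) op_cost A e * vehicle_flow z e)%:E
   + (VOT A * \sum_(e in road_edges A)
        (vehicle_flow z e - rebalancing z e) *
        travel_time e (background A e + vehicle_flow z e))%:E)%E.

Definition log_domain (z : flows R N) : Prop :=
  forall w, w \in od_pairs A -> 0 < amod_demand z w < demand A w.

Definition amod_optimal (y : flows R N * (N * N -> R)) : Prop :=
  amod_feasible y /\ forall y', amod_feasible y' -> profit y' <= profit y.

Definition flow_optimal (S : set (flows R N)) (z : flows R N) : Prop :=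
  S z /\ forall z', S z' -> (flow_cost z <= flow_cost z')%E.

Definition same_optima (S : set (flows R N)) : Prop :=
  [/\ forall y, amod_optimal y <-> amod_feasible y /\ flow_optimal S y.1,
      forall z, flow_optimal S z <-> exists price, amod_optimal (z, price)
    & ereal_sup [set (profit y)%:E | y in [set y | amod_feasible y]] =
      (- ereal_inf [set flow_cost z | z in S])%E].

End Amod.

(* Main.v *)
Require Import Defs.
From mathcomp Require Import all_boot all_order all_algebra.
From mathcomp Require Import finmap.
From mathcomp Require Import ring lra.
From mathcomp Require Import all_classical all_reals all_analysis.
Import Order.TTheory GRing.Theory Num.Theory.
Local Open Scope ring_scope.

(** The logit constraint can be solved for the price.  It forces
    0 < x_od < alpha_od, and on that domain it says
    V^a_od = V^pt_od + ln x_od - ln (alpha_od - x_od), so that the price is a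
    function of the flows, determined on the origin-destination pairs
    ([amod_feasibleE]).  Substituting it into the revenue leaves the entropy
    terms plus VOT times the total passenger time sum_od x_od t_od.  Exchanging
    the sums over pairs, paths and edges turns the latter into
    sum_ij (f_ij - r_ij) T (b_ij + f_ij), because f_ij - r_ij is by definition
    the flow of occupied vehicles ([demand_time_sumE]).  Hence profit and flow
    cost are opposite along a bijection between the feasible points of the two
    problems, up to prices off the pairs.

    It remains to compare the flows with 0 < x_od < alpha_od with all the
    feasible ones.  Optima and optimal values agree as soon as each boundary
    flow costs strictly more than some interior flow ([same_optima_dominated]).
    - If x_od = alpha_od for some pair, the cost is +oo, while interior flows
      have finite cost.  One exists by the next case applied to the zero flow.
    - If x_od = 0 for some pair and no pair is saturated, send a flow eps along
      a candidate path of that pair and bring the empty vehicles back along a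
      road path from d to o, which exists by strong connectivity.  The entropy
      cost changes by eps ln eps + O(eps), all other costs by at most O(eps)
      ([finite_cost_add_trip]).  So the cost decreases for small eps, and one
      fewer pair is idle; repeat until none is.

    The O(eps) bound for congestion needs care when the BPR exponent is below
    1, since T may then have infinite slope at 0.  An edge that already carries
    passengers is away from that point, and on an edge without passengers the
    travel time is multiplied by the O(eps) added passengers. *)

(** * Real inequalities and indicator sums *)

Lemma expR_le1DMexpR (R : realType) (u : R) : expR u <= 1 + u * expR u.
Proof.
have := expR_ge1Dx (- u); rewrite expRN => H.
have e0 := expR_gt0 u.
have : (1 - u) * expR u <= 1 by rewrite -ler_pdivlMr // div1r.
lra.
Qed.

(** Writing q + eps d = q (1 + eps M), the power (1 + eps M)^beta is at most
    exp (eps beta M), which grows at most linearly on bounded intervals.  This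
    covers the concave case beta < 1 and the convex one at once. *)
Lemma powR_increment (R : realType) (q d beta : R) :
  0 < q -> 0 <= d -> 0 <= beta ->
  exists K, forall eps, 0 < eps <= 1 ->
    (q + eps * d) `^ beta <= q `^ beta + eps * K.
Proof.
move=> q0 d0 b0; pose M := d / q.
have M0 : 0 <= M by rewrite divr_ge0 // ltW.
exists (q `^ beta * (beta * M * expR (beta * M))) => eps /andP[e0 e1].
have eM0 : 0 <= eps * M by rewrite mulr_ge0 // ltW.
have -> : q + eps * d = q * (1 + eps * M) by rewrite /M; field; rewrite gt_eqF.
rewrite powRM ?addr_ge0 // ?(ltW q0) //.
rewrite -[X in _ <= X + _]mulr1 [X in _ <= _ + X]mulrCA -mulrDr.
rewrite ler_wpM2l ?powR_ge0 //.
rewrite /(_ `^ _) gt_eqF ?ltr_wpDr //.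
have lnM : ln (1 + eps * M) <= eps * M.
  by rewrite le_ln1Dx // (lt_le_trans _ eM0) ?ltrN10.
apply: (@le_trans _ _ (expR (eps * (beta * M)))).
  by rewrite ler_expR [leRHS]mulrCA ler_wpM2l.
apply: le_trans (expR_le1DMexpR _ _) _.
rewrite lerD2l -[leLHS]mulrA ler_wpM2l ?(ltW e0) //.
have bM0 : 0 <= beta * M by rewrite mulr_ge0.
by rewrite ler_wpM2l // ler_expR ler_piMl.
Qed.

Lemma eps_ln_eps_lt (R : realType) (m K : R) : 0 < m ->
  exists2 eps, 0 < eps <= 1 & eps < m /\ eps * ln eps + eps * K < 0.
Proof.
move=> m0.
(* The third bound makes ln eps + K at most -1. *)
pose eps := Num.min (Num.min 1 (m / 2)) (expR (- K - 1)).
have e0 : 0 < eps by rewrite !lt_min ltr01 divr_gt0 ?expR_gt0.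
have e1 : eps <= 1 by rewrite /eps !ge_min lexx.
have em : eps <= m / 2 by rewrite /eps !ge_min lexx orbT.
have eK : ln eps <= - K - 1.
  by rewrite -[leRHS]expRK ler_ln ?posrE ?expR_gt0 // /eps !ge_min lexx !orbT.
exists eps; first by rewrite e0.
split; first by lra.
rewrite -mulrDr pmulr_rlt0 //; lra.
Qed.

Lemma sum_indicator (R : nzRingType) (I : finType) (P : pred I) (a : I) :
  \sum_(i | P i) (i == a)%:R = (P a)%:R :> R.
Proof.
rewrite big_mkcond (bigD1 a) //= eqxx big1 ?addr0 => [|i /negPf->].
  by case: (P a).
by case: (P i).
Qed.

Lemma sum_indicator_seq (R : nzRingType) (T : eqType) (s : seq T) (a : T) :
  uniq s -> a \in s -> \sum_(i <- s) (i == a)%:R = 1 :> R.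
Proof.
move=> us sa; rewrite (bigD1_seq a) //= eqxx big1 ?addr0 // => i /negPf->.
by [].
Qed.

(** * Eliminating prices and travel times *)

(** The odds x / (a - x) of a logit share x are exp (V - U). *)
Lemma logit_shareE (R : realType) (a V U x : R) : 0 < a ->
  x = a * (expR V / (expR V + expR U)) <->
  0 < x < a /\ V = U + ln x - ln (a - x).
Proof.
move=> a0; have V0 := expR_gt0 V; have U0 := expR_gt0 U.
have D0 : 0 < expR V + expR U by exact: addr_gt0.
split=> [->|[/andP[x0 xa] VE]].
- have ax : a - a * (expR V / (expR V + expR U)) =
            a * (expR U / (expR V + expR U)) by field; rewrite gt_eqF.
  have p0 : 0 < a * (expR V / (expR V + expR U)).
    by rewrite mulr_gt0 // divr_gt0.
  have r0 : 0 < a * (expR U / (expR V + expR U)).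
    by rewrite mulr_gt0 // divr_gt0.
  split; first by rewrite p0 -subr_gt0 ax.
  rewrite ax !lnM ?posrE ?divr_gt0 ?invr_gt0 // !lnV ?posrE // !expRK; ring.
- have ax0 : 0 < a - x by rewrite subr_gt0.
  have -> : expR V = expR U * x / (a - x).
    by rewrite VE expRD expRN expRD !lnK ?posrE.
  have e : expR U != 0 by rewrite gt_eqF.
  have ae : a - x != 0 by rewrite gt_eqF.
  field; rewrite ae /=.
  have -> : expR U * x + expR U * (a - x) = expR U * a by ring.
  by rewrite mulf_neq0 // gt_eqF.
Qed.

Section Amod.
Variables (R : realType) (N : finType) (A : amod_data R N).
Implicit Types (z : flows R N) (w e : N * N).

(** Both sides are the total time spent by the passengers, counted by pair on
    the left and by edge on the right.  The interior assumption cancels the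
    demand in the denominators of the path shares. *)
Lemma demand_time_sumE z : flow_feasible A z -> log_domain A z ->
  \sum_(w in od_pairs A) amod_demand z w * amod_time A z w =
  \sum_(e in road_edges A) (vehicle_flow z e - rebalancing z e) *
     travel_time A e (background A e + vehicle_flow z e).
Proof.
move=> zF zL.
pose T e := travel_time A e (background A e + vehicle_flow z e).
transitivity (\sum_(w in od_pairs A) \sum_(p <- cand_paths A w)
    \sum_(e in road_edges A) path_flow z w p * on_path R e p * T e).
  apply: eq_bigr => w wD; rewrite /amod_time mulr_sumr; apply: eq_bigr => p _.
  have /andP[x0 _] := zL w wD.
  rewrite mulrA mulrCA divff ?gt_eqF // mulr1 mulr_sumr.
  by apply: eq_bigr => e _; rewrite /T mulrA mulrAC.
under eq_bigr do rewrite exchange_big.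
rewrite exchange_big; apply: eq_bigr => e eE.
rewrite (vehicle_flowE zF eE) addrAC subrr add0r -/(T e).
rewrite -(vehicle_flowE zF eE) -/(T e) mulr_suml; apply: eq_bigr => w _.
by rewrite mulr_suml.
Qed.

Definition entropy_cost w (x : R) : R :=
  x * ln x - x * ln (demand A w - x) + x * transit_utility A w.

Definition congestion_cost e (s q : R) : R :=
  s * travel_time A e (background A e + q).

(** The real number equal to [flow_cost] away from saturated pairs; at an idle
    pair, [0 * ln 0 = 0] holds here too. *)
Definition finite_cost z : R :=
  \sum_(w in od_pairs A) entropy_cost w (amod_demand z w)
  + \sum_(e in road_edges A) op_cost A e * vehicle_flow z e
  + VOT A * \sum_(e in road_edges A)
      congestion_cost e (vehicle_flow z e - rebalancing z e) (vehicle_flow z e).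

Lemma flow_cost_finiteE z :
  (forall w, w \in od_pairs A -> 0 <= amod_demand z w < demand A w) ->
  flow_cost A z = (finite_cost z)%:E.
Proof.
move=> zD; rewrite /flow_cost /finite_cost !EFinD; congr (_ + _ + _)%E.
rewrite -sumEFin; apply: eq_bigr => w /zD/andP[x0 xa].
rewrite /entropy_cost [lne (_ - _)%:E]lne_EFin ?subr_gt0 //.
move: x0; rewrite le_eqVlt => /predU1P[<-|x0].
  by rewrite !mul0r !mul0e subrr !addr0 oppe0 !adde0.
by rewrite lne_EFin // -!EFinM -EFinN -!EFinD.
Qed.

Lemma amod_demand_ge0 z w : flow_feasible A z -> w \in od_pairs A ->
  0 <= amod_demand z w.
Proof.
move=> zF wD; rewrite (amod_demandE zF wD) big_seq sumr_ge0 // => p pP.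
exact: (path_flow_ge0 zF wD pP).
Qed.

(** A saturated pair contributes - alpha ln 0 = +oo, and no term of the sum can
    cancel it, since none equals -oo. *)
Lemma flow_cost_saturatedE z w : flow_feasible A z -> w \in od_pairs A ->
  0 < demand A w -> amod_demand z w = demand A w -> flow_cost A z = +oo%E.
Proof.
move=> zF wD a0 xa; rewrite /flow_cost.
suff -> : (\sum_(w in od_pairs A)
     ((amod_demand z w)%:E * lne (amod_demand z w)%:E
      - (amod_demand z w)%:E * lne (demand A w - amod_demand z w)%:E
      + (amod_demand z w * transit_utility A w)%:E) = +oo)%E by [].
apply/esum_eqyP => [i iD|].
  have := amod_demand_ge0 _ _ zF iD; set x := amod_demand z i.
  rewrite le_eqVlt => /predU1P[<-|x0].
    by rewrite !mul0e mul0r sube0 adde0.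
  rewrite [lne x%:E]lne_EFin //.
  have := transit_demand_ge0 zF iD; rewrite /transit_demand -/x.
  rewrite le_eqVlt => /predU1P[<-|ax]; last by rewrite lne_EFin.
  by rewrite [lne 0%:E]le0_lneNy // gt0_muleNy ?lte_fin.
exists w; split=> //.
rewrite xa subrr [lne 0%:E]le0_lneNy // gt0_muleNy ?lte_fin //.
by rewrite lne_EFin.
Qed.

Hypothesis hA : valid_data A.

Lemma amod_feasibleE z price : amod_feasible A (z, price) <->
  [/\ flow_feasible A z, log_domain A z & forall w, w \in od_pairs A ->
    price w = - VOT A * amod_time A z w - transit_utility A w
      - ln (amod_demand z w) + ln (demand A w - amod_demand z w)].
Proof.
split=> [[/= zF zL]|[zF zL pE]].
  have H w (wD : w \in od_pairs A) :=
    (logit_shareE _ _ _ _ _ (demand_gt0 hA wD)).1 (zL w wD).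
  split=> // [w /H[]//|w /H[_]]; rewrite /amod_utility /=; lra.
split=> //= w wD; apply/logit_shareE; first exact: (demand_gt0 hA).
split; first exact: zL.
by rewrite /amod_utility /= pE //; ring.
Qed.

Lemma feasible_costE z price : amod_feasible A (z, price) ->
  flow_cost A z = (- profit A (z, price))%:E.
Proof.
move=> /amod_feasibleE[zF zL pE].
rewrite flow_cost_finiteE; last by move=> w /zL/andP[/ltW-> ->].
congr EFin; rewrite /profit /= opprB addrC /finite_cost.
rewrite /congestion_cost -(demand_time_sumE _ zF zL) mulr_sumr addrAC.
congr (_ + _); rewrite -sumrN -big_split; apply: eq_bigr => w wD /=.
by rewrite pE // /entropy_cost; ring.
Qed.

Lemma exists_price z : flow_feasible A z -> log_domain A z ->
  exists price, amod_feasible A (z, price).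
Proof.
move=> zF zL; exists (fun w => - VOT A * amod_time A z w - transit_utility A w
      - ln (amod_demand z w) + ln (demand A w - amod_demand z w)).
exact/amod_feasibleE.
Qed.

Lemma price_unique z price price' : amod_feasible A (z, price) ->
  amod_feasible A (z, price') -> {in od_pairs A, price' =1 price}.
Proof.
move=> /amod_feasibleE[_ _ pE] /amod_feasibleE[_ _ p'E] w wD.
by rewrite pE ?p'E.
Qed.

(** If every point outside a subset is strictly improved by a point inside,
    restricting a minimization to that subset changes neither the minimizers
    nor the infimum.  Here the subset is the interior, where pricing a flow
    turns its cost into the opposite of a profit. *)
Lemma same_optima_dominated (S : set (flows R N)) :
  (forall z, flow_feasible A z -> log_domain A z -> S z) ->
  (forall z, S z -> flow_feasible A z /\ log_domain A z \/
     exists2 z', flow_feasible A z' /\ log_domain A z' &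
       (flow_cost A z' < flow_cost A z)%E) ->
  same_optima A S.
Proof.
move=> inS dom.
have fS y : amod_feasible A y -> S y.1.
  by case: y => z price /amod_feasibleE[zF zL _]; exact: inS.
have costE y : amod_feasible A y -> flow_cost A y.1 = (- profit A y)%:E.
  by case: y => z price; exact: feasible_costE.
have domf z : S z -> exists2 y, amod_feasible A y &
    (flow_cost A y.1 <= flow_cost A z)%E.
  move=> /dom[[zF zL]|[z' [zF zL] /ltW zz']];
    by have [p pF] := exists_price _ zF zL; eexists; first exact: pF.
have opt_of y : amod_optimal A y -> amod_feasible A y /\ flow_optimal A S y.1.
  move=> [yF ymax]; split=> //; split; first exact: fS.
  move=> z /domf[y' y'F]; apply: le_trans.
  by rewrite !costE // lee_fin lerN2 ymax.
have of_opt y : amod_feasible A y -> flow_optimal A S y.1 -> amod_optimal A y.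
  move=> yF [_ ymin]; split=> // y' y'F.
  by have := ymin _ (fS _ y'F); rewrite !costE // lee_fin lerN2.
split.
- by move=> y; split=> [/opt_of//|[]]; exact: of_opt.
- move=> z; split=> [zO|[price /opt_of[]//]].
  have [Sz zmin] := zO.
  have [[zF zL]|[z' [zF zL]]] := dom z Sz.
    by have [p pF] := exists_price _ zF zL; exists p; exact: of_opt.
  by rewrite ltNge zmin //; exact: inS.
- rewrite -ereal_supN; apply/eqP; rewrite eq_le; apply/andP; split.
    apply: ge_ereal_sup => _ [y yF <-]; apply: ereal_sup_ubound.
    exists (flow_cost A y.1); first by exists y.1 => //; exact: fS.
    by rewrite costE // -EFinN opprK.
  apply: ge_ereal_sup => _ [_ [z Sz <-] <-].
  have [y yF yz] := domf z Sz.
  apply: (@le_trans _ _ (profit A y)%:E).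
    by rewrite leeNl -EFinN -costE.
  by apply: ereal_sup_ubound; exists y.
Qed.


(** * Serving an idle pair *)

(** The number of passages along each edge of the path has divergence
    concentrated at the two end nodes. *)
Lemma path_circulation u q : path (road_rel A) u q ->
  exists2 rho : N * N -> R, forall e, 0 <= rho e &
    forall v, \sum_(e in road_edges A | e.2 == v) rho e -
      \sum_(e in road_edges A | e.1 == v) rho e =
      (v == last u q)%:R - (v == u)%:R.
Proof.
elim: q u => [|y q IH] u /=.
  by move=> _; exists (fun=> 0) => // v; rewrite !big1 // !subrr.
rewrite /road_rel /= => /andP[uyE /IH[rho rho0 rhoE]].
exists (fun e => (e == (u, y))%:R + rho e).
  by move=> e; rewrite addr_ge0.
move=> v; rewrite !big_split /= !sum_indicator /=.
rewrite uyE opprD addrACA rhoE.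
rewrite [y == v]eq_sym [u == v]eq_sym; ring.
Qed.

(** Strong connectivity concerns road nodes only, so the ends of [w], which are
    given as walking nodes, must first be seen to be road nodes: they are ends
    of edges of a candidate path, which is not reduced to one node. *)
Lemma return_trip w : w \in od_pairs A -> cand_paths A w != fset0%fset ->
  exists2 rho : N * N -> R, forall e, 0 <= rho e &
    forall v, \sum_(e in road_edges A | e.2 == v) rho e -
      \sum_(e in road_edges A | e.1 == v) rho e =
      (w.1 == v)%:R - (w.2 == v)%:R.
Proof.
move=> wD /fset0Pn[p /(cand_pathsP hA wD)].
have [_ _ w12] := od_ends hA wD.
case: p => // u [|y q] /and3P[/eqP-> pw /eqP lw].
  by move: lw w12 => /= ->; rewrite eqxx.
have c12 : connect (road_rel A) w.1 w.2 by apply/connectP; exists (y :: q).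
have [n1 _] : w.1 \in road_nodes A /\ y \in road_nodes A.
  by move: pw => /= /andP[/(edge_ends hA)].
have n2 : w.2 \in road_nodes A.
  have : path (road_rel A) w.1 (rcons (belast y q) w.2).
    by rewrite -lw -lastI.
  by rewrite rcons_path => /andP[_ /(edge_ends hA)[]].
have /connectP[r rP ->] := strongly_connected hA n2 n1.
have [rho rho0 rhoE] := path_circulation _ _ rP.
by exists rho => // v; rewrite rhoE !(eq_sym v).
Qed.

(** A flow [eps] of passengers on [p], whose vehicles come back empty along the
    edges weighted by [rho]. *)
Definition add_trip z w p (rho : N * N -> R) (eps : R) : flows R N := Flows
  (fun w' p' => path_flow z w' p' + eps * ((w' == w) && (p' == p))%:R)
  (fun w' => amod_demand z w' + eps * (w' == w)%:R)
  (fun e => vehicle_flow z e + eps * (rho e + on_path R e p))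
  (fun e => rebalancing z e + eps * rho e).

Lemma add_trip_feasible z w p rho eps : flow_feasible A z ->
  w \in od_pairs A -> p \in cand_paths A w ->
  (forall e, 0 <= rho e) ->
  (forall v, \sum_(e in road_edges A | e.2 == v) rho e -
      \sum_(e in road_edges A | e.1 == v) rho e =
      (w.1 == v)%:R - (w.2 == v)%:R) ->
  0 <= eps -> amod_demand z w + eps <= demand A w ->
  flow_feasible A (add_trip z w p rho eps).
Proof.
move=> zF wD pP rho0 rhoE e0 xa.
have sumD w' : w' \in od_pairs A ->
    \sum_(p' <- cand_paths A w') path_flow (add_trip z w p rho eps) w' p' =
    \sum_(p' <- cand_paths A w') path_flow z w' p' + eps * (w' == w)%:R.
  move=> w'D; rewrite big_split /= -mulr_sumr; congr (_ + _ * _).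
  case: eqVneq => [->|_] /=; last by rewrite big1.
  by rewrite sum_indicator_seq ?fset_uniq.
have sumV (P : pred (N * N)) :
    \sum_(w' in od_pairs A | P w')
      \sum_(p' <- cand_paths A w') path_flow (add_trip z w p rho eps) w' p' =
    \sum_(w' in od_pairs A | P w')
      \sum_(p' <- cand_paths A w') path_flow z w' p' + eps * (P w)%:R.
  under eq_bigr => w' /andP[w'D _] do rewrite sumD //.
  by rewrite big_split /= -mulr_sumr sum_indicator wD.
split.
- move=> e eE /=; rewrite (vehicle_flowE zF eE) -!addrA; congr (_ + _).
  rewrite mulrDr addrCA; congr (_ + _).
  under [RHS]eq_bigr => w' w'D do under eq_bigr => p' _ do rewrite mulrDl.
  under [RHS]eq_bigr => w' w'D do rewrite big_split /=.
  rewrite big_split /=; congr (_ + _).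
  rewrite (bigD1 w) //= (bigD1_seq p) //= !eqxx mulr1.
  rewrite big1 => [|p' /negPf->]; last by rewrite mulr0 mul0r.
  rewrite addr0 big1 ?addr0 // => w' /andP[_ /negPf->].
  by rewrite big1 // => p' _; rewrite mulr0 mul0r.
- move=> v vV; rewrite !sumV !big_split /= -!mulr_sumr.
  have B := rebalancing_balance zF vV; have P := congr1 ( *%R eps) (rhoE v).
  move: B P; rewrite !mulrBr; lra.
- by move=> w' w'D; rewrite sumD //= (amod_demandE zF w'D).
- move=> w' p' w'D p'P /=; rewrite addr_ge0 ?mulr_ge0 //.
  exact: (path_flow_ge0 zF).
- move=> w' w'D; rewrite /transit_demand /=.
  have := transit_demand_ge0 zF w'D; rewrite /transit_demand.
  case: eqVneq => [->|_]; rewrite ?mulr1 ?mulr0; lra.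
- by move=> e eE /=; rewrite addr_ge0 ?mulr_ge0 ?(rebalancing_ge0 zF).
Qed.

Lemma travel_time_ge0 e q : e \in road_edges A -> 0 <= travel_time A e q.
Proof.
move=> eE; rewrite mulr_ge0 ?(free_flow_time_ge0 hA) //.
by rewrite addr_ge0 // mulr_ge0 ?(bpr_alpha_ge0 hA) ?powR_ge0.
Qed.

Lemma ler_travel_time e q q' : e \in road_edges A -> 0 <= q <= q' ->
  travel_time A e q <= travel_time A e q'.
Proof.
move=> eE /andP[q0 qq']; have c0 := capacity_gt0 hA eE.
rewrite ler_wpM2l ?(free_flow_time_ge0 hA) // lerD2l.
rewrite ler_wpM2l ?(bpr_alpha_ge0 hA) //.
apply: ge0_ler_powR; rewrite ?nnegrE ?divr_ge0 ?(bpr_beta_ge0 hA) ?(ltW c0) //.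
  exact: le_trans qq'.
by rewrite ler_pM2r ?invr_gt0.
Qed.

Lemma travel_time_increment e q d : e \in road_edges A -> 0 < q -> 0 <= d ->
  exists K, forall eps, 0 < eps <= 1 ->
    travel_time A e (q + eps * d) <= travel_time A e q + eps * K.
Proof.
move=> eE q0 d0; have c0 := capacity_gt0 hA eE.
have qc : 0 < q / capacity A e by rewrite divr_gt0.
have dc : 0 <= d / capacity A e by rewrite divr_ge0 // ltW.
have [K KP] := powR_increment _ _ _ _ qc dc (bpr_beta_ge0 hA).
exists (free_flow_time A e * bpr_alpha A * K) => eps /KP.
rewrite mulrA -mulrDl => H.
have t0 := mulr_ge0 (free_flow_time_ge0 hA eE) (bpr_alpha_ge0 hA).
have := ler_wpM2l t0 H; rewrite /travel_time; lra.
Qed.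

(** With [s] passengers, the increment splits into the travel time of the added
    ones, of order [eps], and [s] times a travel time increment.  The latter
    vanishes for s = 0; otherwise the edge carries flow f >= s > 0, where the
    travel time grows at most linearly. *)
Lemma congestion_increment e s f ds df : e \in road_edges A ->
  0 <= background A e -> 0 <= s <= f -> 0 <= ds -> 0 <= df ->
  exists K, forall eps, 0 < eps <= 1 ->
    congestion_cost e (s + eps * ds) (f + eps * df) <=
    congestion_cost e s f + eps * K.
Proof.
move=> eE b0 /andP[s0 sf] ds0 df0; set b := background A e in b0 *.
have : exists K, forall eps, 0 < eps <= 1 ->
    s * travel_time A e (b + (f + eps * df)) <=
    s * travel_time A e (b + f) + eps * K.
  move: s0; rewrite le_eqVlt => /predU1P[<-|s0].
    by exists 0 => eps _; rewrite !mul0r mulr0 addr0.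
  have bf : 0 < b + f by rewrite ltr_wpDl // (lt_le_trans s0).
  have [K KP] := travel_time_increment _ _ _ eE bf df0.
  exists (s * K) => eps /KP H; rewrite addrA [X in _ <= _ + X]mulrCA -mulrDr.
  by rewrite ler_wpM2l // ltW.
move=> [K KP]; exists (ds * travel_time A e (b + (f + df)) + K) => eps eP.
rewrite /congestion_cost -/b.
have /andP[e0 e1] := eP.
have T1 : travel_time A e (b + (f + eps * df)) <=
    travel_time A e (b + (f + df)).
  apply: ler_travel_time => //; rewrite !lerD2l ler_piMl // andbT.
  by rewrite !addr_ge0 ?mulr_ge0 ?(le_trans s0 sf) // ltW.
have ed : 0 <= eps * ds by rewrite mulr_ge0 // ltW.
have := ler_wpM2l ed T1; have := KP _ eP; lra.
Qed.

Lemma served_flow_ge0 z e : flow_feasible A z -> e \in road_edges A ->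
  0 <= vehicle_flow z e - rebalancing z e.
Proof.
move=> zF eE; rewrite (vehicle_flowE zF eE) addrAC subrr add0r.
rewrite sumr_ge0 // => w wD; rewrite big_seq sumr_ge0 // => p pP.
by rewrite mulr_ge0 ?(path_flow_ge0 zF).
Qed.

(** The slope of x ln x at 0 is -oo: for small [eps] the term [eps * ln eps]
    outweighs all the others, which are bounded by a multiple of [eps]. *)
Lemma finite_cost_add_trip z w p rho : flow_feasible A z ->
  (forall e, e \in road_edges A -> 0 <= background A e) ->
  w \in od_pairs A -> amod_demand z w = 0 -> (forall e, 0 <= rho e) ->
  exists K, forall eps, 0 < eps <= 1 -> eps < demand A w / 2 ->
    finite_cost (add_trip z w p rho eps) <=
    finite_cost z + eps * ln eps + eps * K.
Proof.
move=> zF b0 wD xw rho0.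
pose s e := vehicle_flow z e - rebalancing z e.
have /choice[K KP] : forall e, exists K, e \in road_edges A ->
    forall eps, 0 < eps <= 1 ->
    congestion_cost e (s e + eps * on_path R e p)
      (vehicle_flow z e + eps * (rho e + on_path R e p)) <=
    congestion_cost e (s e) (vehicle_flow z e) + eps * K.
  move=> e; have [eE|_] := boolP (e \in road_edges A); last by exists 0.
  have [|||K KP] :=
    congestion_increment e (s e) (vehicle_flow z e) (on_path R e p)
      (rho e + on_path R e p) eE (b0 e eE).
  - by rewrite served_flow_ge0 //= gerBl (rebalancing_ge0 zF).
  - by [].
  - by rewrite addr_ge0.
  - by exists K.
pose C := \sum_(e in road_edges A) op_cost A e * (rho e + on_path R e p).
exists (- ln (demand A w / 2) + transit_utility A w + C +
  VOT A * \sum_(e in road_edges A) K e).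
move=> eps eP ea; have /andP[e0 e1] := eP.
have a0 := demand_gt0 hA wD.
have lnE : - ln (demand A w - eps) <= - ln (demand A w / 2).
  rewrite lerN2 ler_ln ?posrE; lra.
have E : \sum_(w' in od_pairs A)
      entropy_cost w' (amod_demand (add_trip z w p rho eps) w') <=
    \sum_(w' in od_pairs A) entropy_cost w' (amod_demand z w') +
    eps * ln eps + eps * (- ln (demand A w / 2) + transit_utility A w).
  rewrite (bigD1 w) //= (bigD1 w wD) /= eqxx mulr1 xw add0r.
  rewrite (eq_bigr (fun w' => entropy_cost w' (amod_demand z w'))); last first.
    by move=> w' /andP[_ /negPf->]; rewrite mulr0 addr0.
  have := ler_wpM2l (ltW e0) lnE; rewrite /entropy_cost !mul0r; lra.
have F : \sum_(e in road_edges A)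
      op_cost A e * vehicle_flow (add_trip z w p rho eps) e =
    \sum_(e in road_edges A) op_cost A e * vehicle_flow z e + eps * C.
  rewrite mulr_sumr -big_split; apply: eq_bigr => e _ /=; ring.
have G : \sum_(e in road_edges A) congestion_cost e
      (vehicle_flow (add_trip z w p rho eps) e -
       rebalancing (add_trip z w p rho eps) e)
      (vehicle_flow (add_trip z w p rho eps) e) <=
    \sum_(e in road_edges A) congestion_cost e (s e) (vehicle_flow z e) +
    eps * \sum_(e in road_edges A) K e.
  rewrite mulr_sumr -big_split ler_sum //= => e eE.
  have -> : vehicle_flow z e + eps * (rho e + on_path R e p) -
      (rebalancing z e + eps * rho e) = s e + eps * on_path R e p.
    by rewrite /s; ring.
  exact: KP.
rewrite /finite_cost F; have := ler_wpM2l (ltW (VOT_gt0 hA)) G.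
move: E; rewrite /s; lra.
Qed.

Lemma serve_idle_pair z w : flow_feasible A z ->
  (forall w', w' \in od_pairs A -> amod_demand z w' < demand A w') ->
  (forall e, e \in road_edges A -> 0 <= background A e) ->
  w \in od_pairs A -> cand_paths A w != fset0%fset -> amod_demand z w = 0 ->
  exists z', [/\ flow_feasible A z',
    forall w', w' \in od_pairs A -> amod_demand z' w' < demand A w',
    0 < amod_demand z' w,
    forall w', w' != w -> amod_demand z' w' = amod_demand z w'
    & finite_cost z' < finite_cost z].
Proof.
move=> zF xa b0 wD wP xw.
have [rho rho0 rhoE] := return_trip w wD wP.
have /fset0Pn[p pP] := wP.
have [K KP] := finite_cost_add_trip z w p rho zF b0 wD xw rho0.
have a0 := demand_gt0 hA wD.
have m0 : 0 < demand A w / 2 by rewrite divr_gt0.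
have [eps eP [ea cost_lt]] := eps_ln_eps_lt _ _ K m0.
have /andP[e0 _] := eP.
exists (add_trip z w p rho eps); split.
- by apply: add_trip_feasible; rewrite ?xw //; lra.
- move=> w' w'D /=; have := xa _ w'D.
  case: eqVneq => [->|_]; rewrite ?xw ?mulr1 ?mulr0; lra.
- by rewrite /= eqxx xw mulr1 add0r.
- by move=> w' /negPf /= ->; rewrite mulr0 addr0.
- by apply: le_lt_trans (KP _ eP ea) _; lra.
Qed.

(** * Interior flows dominate boundary flows *)

Lemma interior_improvement z : flow_feasible A z ->
  (forall w, w \in od_pairs A -> amod_demand z w < demand A w) ->
  (forall e, e \in road_edges A -> 0 <= background A e) ->
  (forall w, w \in od_pairs A -> cand_paths A w != fset0%fset) ->
  log_domain A z \/
  exists z', [/\ flow_feasible A z', log_domain A z' &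
    finite_cost z' < finite_cost z].
Proof.
move=> + + b0 PN.
pose idle z' := [set w in od_pairs A | amod_demand z' w == 0].
have [n] := ubnP #|idle z|; elim: n z => // n IH z idle_n zF xa.
have [/eqP i0|[w]] := set_0Vmem (idle z).
  left=> w wD; rewrite xa // andbT lt_neqAle amod_demand_ge0 // andbT eq_sym.
  apply: contraTN i0 => x0.
  by apply/set0Pn; exists w; rewrite inE wD.
rewrite inE => /andP[wD /eqP xw]; right.
have [z' [z'F x'a x'w x'E z'z]] := serve_idle_pair z w zF xa b0 wD (PN w wD) xw.
have idle_lt : (#|idle z'| < #|idle z|)%N.
  apply/proper_card/properP; split.
    apply/fintype.subsetP => v; rewrite !inE => /andP[-> /eqP v0] /=.
    rewrite -x'E ?v0 //; apply: contraTneq x'w => <-.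
    by rewrite v0 ltxx.
  by exists w; rewrite !inE ?wD ?xw ?eqxx // gt_eqF.
have [|z'L|[z'' [z''F z''L z''z']]] := IH z' _ z'F x'a.
- exact: leq_trans idle_lt _.
- by exists z'.
- by exists z''; split=> //; exact: lt_trans z'z.
Qed.

(** A feasible flow that saturates no pair, from which to reach the interior. *)
Definition no_service : flows R N :=
  Flows (fun=> fun=> 0) (fun=> 0) (fun=> 0) (fun=> 0).

Lemma no_service_feasible : flow_feasible A no_service.
Proof.
split=> //=.
- move=> e _; rewrite add0r big1 // => w _.
  by rewrite big1 // => p _; rewrite mul0r.
- by move=> v _; rewrite !big1 ?subrr // => w _; rewrite big1.
- by move=> w _; rewrite big1.
- by move=> w wD; rewrite /transit_demand subr0 ltW // (demand_gt0 hA).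
Qed.

Lemma dominated_by_interior z :
  (forall w, w \in od_pairs A -> cand_paths A w != fset0%fset) ->
  (forall e, e \in road_edges A -> 0 <= background A e) ->
  flow_feasible A z ->
  flow_feasible A z /\ log_domain A z \/
  exists2 z', flow_feasible A z' /\ log_domain A z' &
    (flow_cost A z' < flow_cost A z)%E.
Proof.
move=> PN b0 zF.
have finE z' : log_domain A z' -> flow_cost A z' = (finite_cost z')%:E.
  by move=> z'L; apply: flow_cost_finiteE => w /z'L/andP[/ltW-> ->].
have [xa|] := pselect (forall w, w \in od_pairs A ->
    amod_demand z w < demand A w).
  have [|[z' [z'F z'L z'z]]] := interior_improvement z zF xa b0 PN.
    by left.
  right; exists z' => //; rewrite finE // flow_cost_finiteE ?lte_fin //.
  by move=> w wD; rewrite amod_demand_ge0 // xa.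
move=> /existsNP[w /not_implyP[wD /negP]]; rewrite -leNgt => aw.
have xw : amod_demand z w = demand A w.
  apply/eqP; rewrite eq_le aw andbT -subr_ge0.
  exact: (transit_demand_ge0 zF).
right.
suff [z' z'F z'L] : exists2 z', flow_feasible A z' & log_domain A z'.
  exists z' => //; rewrite finE // (flow_cost_saturatedE z w) ?ltry //.
  exact: (demand_gt0 hA).
have [||[z' [? ? _]]] :=
  interior_improvement no_service no_service_feasible _ b0 PN.
- by move=> v vD; exact: (demand_gt0 hA).
- by exists no_service => //; exact: no_service_feasible.
- by exists z'.
Qed.

End Amod.

Theorem lemma4p3 (R : realType) (N : finType) (A : amod_data R N)
    (hA : valid_data A) :
  [/\ forall z price, amod_feasible A (z, price) ->
        [/\ flow_feasible A z, log_domain A z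
          & flow_cost A z = (- profit A (z, price))%:E],
      forall z, flow_feasible A z -> log_domain A z ->
        exists2 price, amod_feasible A (z, price) &
          forall price', amod_feasible A (z, price') ->
            {in od_pairs A, price' =1 price},
      same_optima A [set z | flow_feasible A z /\ log_domain A z]
    & (forall w, w \in od_pairs A -> cand_paths A w != fset0) ->
      (forall e, e \in road_edges A -> 0 <= background A e) ->
      same_optima A [set z | flow_feasible A z]].
Proof.
split.
- move=> z price zpF; have [zF zL _] := (amod_feasibleE _ _ _ hA _ _).1 zpF.
  by split=> //; exact: feasible_costE.
- move=> z zF zL; have [price pF] := exists_price _ _ _ hA _ zF zL.
  by exists price => // price'; exact: price_unique.
- by apply: same_optima_dominated => // z zS; left.
- move=> PN b0; apply: same_optima_dominated => // z zF.
  exact: dominated_by_interior.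
Qed.
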